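(* Let $f:\mathbb{R}^d\to\mathbb{R}$ be a convex differentiable function with nonempty set of minimizers $\mathcal{X}_\star$, let $f_\star=\min f$, and let $x_\star\in\mathcal{X}_\star$. Let $\mathbf{C}:\mathbb{R}^d\to\mathbb{S}^d_+$ and $L_{\mathbf{C}}\ge 0$ be such that for all $x,y\in\mathbb{R}^d$ $$f(y)+\langle\nabla f(y),x-y\rangle+\tfrac12\|x-y\|^2_{\mathbf{C}(y)}\le f(x)\le f(y)+\langle\nabla f(y),x-y\rangle+\tfrac12\|x-y\|^2_{\mathbf{C}(y)+L_{\mathbf{C}}\mathbf{I}}.$$ Let $x_0\in\mathbb{R}^d$ and let $(x_k)_{k\ge 0}$ be the iterates of LCD1 (Local Curvature Descent 1), i.e. $$x_{k+1}=x_k-\left[\mathbf{C}(x_k)+L_{\mathbf{C}}\mathbf{I}\right]^{-1}\nabla f(x_k),\qquad k\ge 0,$$ where the matrices $\mathbf{C}(x_k)+L_{\mathbf{C}}\mathbf{I}$ are assumed invertible (automatic if $L_{\mathbf{C}}>0$). Then for all $k\ge 1$, $$f(x_k)-f_\star\le\frac{L_{\mathbf{C}}\|x_0-x_\star\|^2}{2k}.$$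
   Context: $\mathbb{S}^d_+$ is the set of symmetric positive semi-definite $d\times d$ real matrices, $\mathbf{I}$ is the $d\times d$ identity matrix, $\langle\cdot,\cdot\rangle$ and $\|\cdot\|$ are the standard Euclidean inner product and norm on $\mathbb{R}^d$, and $\|z\|^2_{\mathbf{A}}=\langle\mathbf{A}z,z\rangle$ for $\mathbf{A}\in\mathbb{S}^d_+$. *)

(* Defs.v *)
From HB Require Import structures.
From mathcomp Require Import all_boot all_order all_algebra.
From mathcomp Require Import all_classical all_reals all_analysis.

Set Implicit Arguments.
Unset Strict Implicit.
Unset Printing Implicit Defensive.

Import Order.TTheory GRing.Theory Num.Theory.
Import numFieldNormedType.Exports.

Local Open Scope classical_set_scope.
Local Open Scope ring_scope.

Section LocalCurvatureDescent.
Variables (R : realType) (d : nat).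
Implicit Types (x y z : 'cV[R]_d) (A : 'M[R]_d) (f : 'cV[R]_d -> R).

Definition dotv x y : R := \sum_i x i 0 * y i 0.

(* The library norm `|x| on 'cV[R]_d is the sup norm. It induces the same
   topology, hence the same notion of differentiability, but the estimates
   have to be stated with the Euclidean norm. *)
Definition enorm x : R := Num.sqrt (dotv x x).

Definition sqnorm_mx A z : R := dotv (A *m z) z.

Definition psd A : Prop :=
  A \is symmetricmx /\ forall z, 0 <= sqnorm_mx A z.

Definition gradient f x : 'cV[R]_d := \col_i 'D_(delta_mx i 0) f x.

Definition minimizers f : set 'cV[R]_d := [set x | forall y, f x <= f y].

Definition is_minimum f (m : R) : Prop := range f m /\ lbound (range f) m.

(* invmx returns its argument on a singular matrix, so this is the intended
   step only when C x + L%:M is invertible. *)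
Definition LCD1_step f (C : 'cV[R]_d -> 'M[R]_d) (L : R) x : 'cV[R]_d :=
  x - invmx (C x + L%:M) *m gradient f x.

End LocalCurvatureDescent.

(* Main.v *)
Require Import Defs.
From HB Require Import structures.
From mathcomp Require Import all_boot all_order all_algebra.
From mathcomp Require Import all_classical all_reals all_analysis.
From mathcomp Require Import ring lra.

(** The proof rests on one inequality for a single step, valid against every
    comparison point [z]: if [x'] is the step from [x], then

      [f x' + L/2 |z - x'|^2 <= f z + L/2 |z - x|^2]   ([LCD1_step_le]).

    To see it, let [Q] be the quadratic upper model of [f] at [x], with Hessian
    [M = C x + L I].  The step is the stationary point of [Q], so completing
    the square gives [Q z = Q x' + 1/2 |z - x'|_M^2]
    ([quadratic_model_stationary]).  On the one hand [f x' <= Q x'].  On the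
    other hand [Q z] exceeds the lower model at [z] by exactly
    [L/2 |z - x|^2], because the two models share the curvature [C x]; hence
    [Q z <= f z + L/2 |z - x|^2].  Finally [|.|_M^2 >= L |.|^2] since [C x] is
    positive semi-definite.

    Taking [z = x] shows that the values [f x_k] decrease.  Taking [z] a
    minimizer and telescoping bounds the sum of the gaps [f x_i - f z] for
    [i = 1, ..., k] by [L/2 |x_0 - z|^2], and by monotonicity this sum is at
    least [k (f x_k - f z)] ([step_potential_le]). *)

Set Implicit Arguments.
Unset Strict Implicit.
Unset Printing Implicit Defensive.

Import Order.TTheory GRing.Theory Num.Theory.
Import numFieldNormedType.Exports.

Local Open Scope classical_set_scope.
Local Open Scope ring_scope.

Section Dotv.
Variables (R : realType) (d : nat).
Implicit Types (x y z : 'cV[R]_d) (A B : 'M[R]_d).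

Lemma dotvE x y : dotv x y = (x^T *m y) 0 0.
Proof. by rewrite mxE; apply: eq_bigr => i _; rewrite mxE. Qed.

Lemma dotvC x y : dotv x y = dotv y x.
Proof. by apply: eq_bigr => i _; rewrite mulrC. Qed.

Lemma dotvDl x y z : dotv (x + y) z = dotv x z + dotv y z.
Proof. by rewrite !dotvE linearD mulmxDl mxE. Qed.

Lemma dotvNl x y : dotv (- x) y = - dotv x y.
Proof. by rewrite !dotvE linearN mulNmx mxE. Qed.

Lemma dotvBl x y z : dotv (x - y) z = dotv x z - dotv y z.
Proof. by rewrite dotvDl dotvNl. Qed.

Lemma dotvBr x y z : dotv x (y - z) = dotv x y - dotv x z.
Proof. by rewrite dotvC dotvBl !(dotvC x). Qed.

Lemma dotvZl (a : R) x y : dotv (a *: x) y = a * dotv x y.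
Proof. by rewrite !dotvE linearZ -scalemxAl mxE. Qed.

Lemma dotv0l x : dotv 0 x = 0.
Proof. by rewrite dotvE linear0 mul0mx mxE. Qed.

Lemma dotvv_ge0 x : 0 <= dotv x x.
Proof. by apply: sumr_ge0 => i _; rewrite -expr2 sqr_ge0. Qed.

Lemma sqr_enorm x : enorm x ^+ 2 = dotv x x.
Proof. by rewrite sqr_sqrtr ?dotvv_ge0. Qed.

Lemma dotv_symmetric A x y : A^T = A -> dotv (A *m x) y = dotv (A *m y) x.
Proof.
by move=> sA; rewrite [RHS]dotvC !dotvE trmx_mul sA mulmxA.
Qed.

Lemma sqnorm_mxDscalar A (a : R) z :
  sqnorm_mx (A + a%:M) z = sqnorm_mx A z + a * dotv z z.
Proof. by rewrite /sqnorm_mx mulmxDl mul_scalar_mx dotvDl dotvZl. Qed.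

(** Completing the square: [s] is a stationary point of
    [u |-> dotv g u + 1/2 |u|_A^2], so the model has no first-order term when
    expanded around [s]. *)
Lemma quadratic_model_stationary A g s u : A^T = A -> A *m s = - g ->
  dotv g u + 2^-1 * sqnorm_mx A u =
  dotv g s + 2^-1 * sqnorm_mx A s + 2^-1 * sqnorm_mx A (u - s).
Proof.
move=> sA Asg; have -> : g = - (A *m s) by rewrite Asg opprK.
rewrite /sqnorm_mx mulmxBr !dotvNl !dotvBl !dotvBr (dotv_symmetric u s sA).
by field.
Qed.

End Dotv.

Section Step.
Variables (R : realType) (d : nat) (f : 'cV[R]_d -> R).
Variables (C : 'cV[R]_d -> 'M[R]_d) (L : R).
Hypothesis C_psd : forall x, psd (C x).
Hypothesis f_lower : forall x y : 'cV[R]_d,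
  f y + dotv (gradient f y) (x - y) + 2^-1 * sqnorm_mx (C y) (x - y) <= f x.
Hypothesis f_upper : forall x y : 'cV[R]_d,
  f x <= f y + dotv (gradient f y) (x - y)
         + 2^-1 * sqnorm_mx (C y + L%:M) (x - y).

Lemma LCD1_step_stationary x : C x + L%:M \in unitmx ->
  (C x + L%:M) *m (LCD1_step f C L x - x) = - gradient f x.
Proof.
by move=> uM; rewrite /LCD1_step addrAC subrr add0r mulmxN mulKVmx.
Qed.

(** The two models at [x] differ by [L/2 |z - x|^2], while the gap between the
    upper model at [z] and at the step is at least [L/2 |z - x'|^2]. *)
Lemma LCD1_step_le x z : C x + L%:M \in unitmx ->
  f (LCD1_step f C L x) + L / 2 * enorm (z - LCD1_step f C L x) ^+ 2
    <= f z + L / 2 * enorm (z - x) ^+ 2.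
Proof.
move=> uM; have [/is_hermitianmxP symC C_ge0] := C_psd x.
have sM : (C x + L%:M)^T = C x + L%:M.
  by rewrite linearD /= tr_scalar_mx [in RHS]symC expr0 scale1r map_mx_id.
have sq := quadratic_model_stationary (z - x) sM (LCD1_step_stationary uM).
move: sq (f_upper (LCD1_step f C L x) x) (f_lower z x).
set x' := LCD1_step f C L x.
rewrite (_ : z - x - (x' - x) = z - x'); last by rewrite opprB addrA subrK.
rewrite !sqnorm_mxDscalar !sqr_enorm.
by have := C_ge0 (z - x'); lra.
Qed.

Lemma LCD1_step_descent x : 0 <= L -> C x + L%:M \in unitmx ->
  f (LCD1_step f C L x) <= f x.
Proof.
move=> L_ge0 uM; have := LCD1_step_le x uM.
rewrite !sqr_enorm subrr dotv0l mulr0 addr0; apply: le_trans.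
by rewrite lerDl mulr_ge0 ?dotvv_ge0 ?divr_ge0.
Qed.

End Step.

(** A sublinear rate from a potential: [k (a_k - m) + b_k] is nonincreasing,
    because passing from [k] to [k + 1] the decrease of [a] takes care of the
    factor [k] and the decrease of [b] pays for the extra copy of the gap. *)
Lemma step_potential_le (R : realType) (a b : nat -> R) (m : R) :
    (forall k, a k.+1 <= a k) ->
    (forall k, a k.+1 + b k.+1 <= m + b k) ->
  forall k, k%:R * (a k - m) + b k <= b 0%N.
Proof.
move=> a_dec ab_step; elim=> [|k IHk]; first by rewrite mul0r add0r.
apply: le_trans IHk; rewrite -[k.+1]addn1 natrD mulrDl mul1r addn1.
have := ler_wpM2l (ler0n R k) (lerB (a_dec k) (lexx m)).
by have := ab_step k; lra.
Qed.

Theorem theorem4p1 (R : realType) (d : nat) (f : 'cV[R]_d -> R)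
  (f_convex : convex_function [set: 'cV[R]_d] f)
  (f_diff : forall x : 'cV[R]_d, differentiable f x)
  (f_has_min : minimizers f !=set0)
  (fstar : R) (fstar_min : is_minimum f fstar)
  (xstar : 'cV[R]_d) (xstar_min : minimizers f xstar)
  (C : 'cV[R]_d -> 'M[R]_d) (C_psd : forall x : 'cV[R]_d, psd (C x))
  (L : R) (L_ge0 : 0 <= L)
  (f_lower : forall x y : 'cV[R]_d,
     f y + dotv (gradient f y) (x - y) + 2^-1 * sqnorm_mx (C y) (x - y) <= f x)
  (f_upper : forall x y : 'cV[R]_d,
     f x <= f y + dotv (gradient f y) (x - y)
            + 2^-1 * sqnorm_mx (C y + L%:M) (x - y))
  (x0 : 'cV[R]_d) (x_ : nat -> 'cV[R]_d)
  (x_0 : x_ 0%N = x0)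
  (x_unit : forall k : nat, C (x_ k) + L%:M \in unitmx)
  (x_S : forall k : nat, x_ k.+1 = LCD1_step f C L (x_ k)) :
  forall k : nat, (1 <= k)%N ->
    f (x_ k) - fstar <= L * enorm (x0 - xstar) ^+ 2 / (2 * k%:R).
Proof.
move=> k k_gt0.
have -> : fstar = f xstar.
  have [[y _ <-] lb] := fstar_min.
  by apply/le_anti; rewrite xstar_min lb //; exists xstar.
have dec j : f (x_ j.+1) <= f (x_ j).
  by rewrite x_S; exact: LCD1_step_descent (x_unit j).
have step j : f (x_ j.+1) + L / 2 * enorm (xstar - x_ j.+1) ^+ 2
    <= f xstar + L / 2 * enorm (xstar - x_ j) ^+ 2.
  by rewrite x_S; exact: LCD1_step_le (x_unit j).
have := step_potential_le (a := fun j => f (x_ j))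
  (b := fun j => L / 2 * enorm (xstar - x_ j) ^+ 2) dec step k.
have enormBC : enorm (xstar - x0) = enorm (x0 - xstar).
  by rewrite -opprB /enorm dotvNl dotvC dotvNl opprK.
rewrite /= x_0 enormBC => pot.
have b_ge0 : 0 <= L / 2 * enorm (xstar - x_ k) ^+ 2.
  by rewrite mulr_ge0 ?sqr_ge0 ?divr_ge0.
rewrite ler_pdivlMr ?mulr_gt0 ?ltr0n //.
by lra.
Qed.
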